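(* Let $k\ge 0$, let $X_k$ be a set of $k$-element matroids, and let $X_{k+1}$ be the output of the isomorph-free extension procedure (described in the context) applied to $X_k$. If $X_k$ contains exactly one representative from each isomorphism class of $k$-element matroids, then $X_{k+1}$ contains exactly one representative from each isomorphism class of $(k+1)$-element matroids.
   Context: Matroids. A matroid $M=(E,r)$ is a finite set $E$ together with a rank function $r:2^E\to\mathbb{Z}$ satisfying: (R1) $0\le r(A)\le|A|$ for all $A\subseteq E$; (R2) $r(A)\le r(B)$ whenever $A\subseteq B\subseteq E$; (R3) $r(A\cap B)+r(A\cup B)\le r(A)+r(B)$ for all $A,B\subseteq E$. Matroids $(E_1,r_1)$ and $(E_2,r_2)$ are isomorphic if there is a bijection $\rho:E_1\to E_2$ with $r_2(\rho(A))=r_1(A)$ for all $A\subseteq E_1$. A flat is a set $F\subseteq E$ with $r(F\cup\{e\})>r(F)$ for all $e\in E\setminus F$; $\mathcal{F}(M)$ denotes the set of flats, partially ordered by inclusion. A flat $A$ covers a flat $B$ if $B\subset A$ (strictly) and no flat lies strictly between them. A hyperplane is a flat of rank $r(E)-1$. For $e\in E$, the deletion $M\backslash e$ is the matroid on $E\setminus\{e\}$ whose rank function is the restriction of $r$; $M$ is then called a single-element extension of $M\backslash e$. Modular cuts. Two flats $F,G$ of $N$ form a modular pair if $r(F)+r(G)=r(F\cup G)+r(F\cap G)$. A modular cut of a matroid $N$ is a (possibly empty) set $\mathcal{F}_3\subseteq\mathcal{F}(N)$ that is an up-set (every flat containing a member of $\mathcal{F}_3$ is in $\mathcal{F}_3$)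 and is closed under taking intersections of modular pairs of flats. Its collar $\mathcal{F}_2$ is the set of flats not in $\mathcal{F}_3$ that are covered by some member of $\mathcal{F}_3$, and $\mathcal{F}_1=\mathcal{F}(N)\setminus(\mathcal{F}_2\cup\mathcal{F}_3)$. The single-element extension of $N$ determined by the modular cut $\mathcal{F}_3$ is the matroid $M$ on the ground set of $N$ together with a new element $e$ whose set of flats is $$\mathcal{F}(M)=\mathcal{F}_1\cup\mathcal{F}_2\cup\{F\cup\{e\} : F\in\mathcal{F}_1\cup\mathcal{F}_3\}.$$ By a known theorem of Crapo, this gives a one-to-one correspondence between modular cuts of $N$ and single-element extensions of $N$ (by the element $e$). Hyperplane graph and canonical labelling. The hyperplane graph $\mathcal{H}(M)$ is the bipartite graph whose vertices are the elements and the hyperplanes of $M$, with the bipartition (element-vertices, hyperplane-vertices) fixed, a hyperplane-vertex being adjacent to an element-vertex if and only if the hyperplane contains the element. Isomorphisms and automorphisms of hyperplane graphs are required to map element-vertices to element-vertices and hyperplane-vertices to hyperplane-vertices. Fix a canonical labelling: a rule assigning to each such bipartite graph $\mathcal{H}$ a bijection from its vertex set to $\{1,\dots,|V(\mathcal{H})|\}$ such that any two isomorphic graphs become identical (including the bipartition) after their vertices are relabelled by their assigned bijections. ''Orbit'' below means orbit of the automorphism group of $\mathcal{H}(M)$. The procedure. Input: a set $X_k$ of $k$-element matroids. Start with $X_{k+1}=\emptyset$. For each matroid $N\in X_k$: (1) set $N^+=\emptyset$; (2) for each modular cut of $N$, form the single-element extension $M$ of $N$ determined by this modular cut, canonically label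 $\mathcal{H}(M)$, and add $M$ to $N^+$ if and only if the newly added element is in the same orbit as the element-vertex of $\mathcal{H}(M)$ having the lowest canonical label among element-vertices; (3) filter isomorphic matroids from $N^+$, that is, keep exactly one matroid from each isomorphism class occurring in $N^+$, and add the remaining matroids to $X_{k+1}$. The output is $X_{k+1}$. *)

(* Defs.v *)
From HB Require Import structures.
From mathcomp Require Import all_boot all_order all_algebra.

Set Implicit Arguments.
Unset Strict Implicit.
Unset Printing Implicit Defensive.

Import Order.TTheory GRing.Theory Num.Theory.
Local Open Scope ring_scope.

Record matroid_on (E : finType) := MatroidOn {
  rk : {set E} -> int;
  rk_bounds : forall A : {set E}, 0 <= rk A <= #|A|%:Z;
  rk_mono : forall A B : {set E}, A \subset B -> rk A <= rk B;
  rk_submod : forall A B : {set E}, rk (A :&: B) + rk (A :|: B) <= rk A + rk B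
}.

(* A matroid on an arbitrary finite ground set. Classes of matroids are
   predicates [matroid -> Prop], compared up to Leibniz equality of members. *)
Record matroid := Matroid {
  ground : finType;
  mstruct :> matroid_on ground
}.

Definition matroid_iso (M1 M2 : matroid) : Prop :=
  exists2 rho : ground M1 -> ground M2, bijective rho &
    forall A : {set ground M1}, rk M2 (rho @: A) = rk M1 A.

Section Flats.
Variables (E : finType) (M : matroid_on E).

Definition is_flat (F : {set E}) : bool :=
  [forall e, (e \notin F) ==> (rk M F < rk M (F :|: [set e]))].

Definition flats : {set {set E}} := [set F | is_flat F].

Definition covers (A B : {set E}) : bool :=
  (B \proper A) && ~~ [exists F in flats, (B \proper F) && (F \proper A)].

Definition is_hyperplane (H : {set E}) : bool :=
  is_flat H && (rk M H == rk M [set: E] - 1).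

Definition modular_pair (F G : {set E}) : bool :=
  rk M F + rk M G == rk M (F :|: G) + rk M (F :&: G).

Definition modular_cut (C : {set {set E}}) : Prop :=
  [/\ C \subset flats,
      forall F G, F \in C -> G \in flats -> F \subset G -> G \in C &
      forall F G, F \in C -> G \in C -> modular_pair F G -> F :&: G \in C].

Definition collar (C : {set {set E}}) : {set {set E}} :=
  [set F in flats | (F \notin C) && [exists G in C, covers G F]].

(* The flats of the extension; the new element is [None : option E]. *)
Definition extension_flats (C : {set {set E}}) : {set {set option E}} :=
  let F3 := C in
  let F2 := collar C in
  let F1 := flats :\: (F2 :|: F3) in
  [set Some @: (F : {set E}) | F in F1 :|: F2] :|:
  [set (Some @: (F : {set E})) :|: [set None] | F in F1 :|: F3].

End Flats.

Definition extension_by (E : finType) (N : matroid_on E) (C : {set {set E}})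
    (M : matroid_on (option E)) : Prop :=
  flats M = extension_flats N C.

(* Bipartite graphs with a fixed bipartition into element-vertices
   ([is_elem v]) and hyperplane-vertices ([~~ is_elem v]). *)
Record bigraph := BiGraph {
  vert : finType;
  is_elem : pred vert;
  edge : rel vert;
  edge_sym : symmetric edge;
  edge_bip : forall u v, edge u v -> is_elem u != is_elem v
}.

Definition graph_isomorphism (G H : bigraph) (phi : vert G -> vert H) : Prop :=
  [/\ bijective phi,
      forall v, is_elem (phi v) = is_elem v &
      forall u v, edge (phi u) (phi v) = edge u v].

Definition same_orbit (G : bigraph) (u v : vert G) : Prop :=
  exists2 phi : vert G -> vert G, graph_isomorphism phi & phi u = v.

Section HyperplaneGraph.
Variables (E : finType) (M : matroid_on E).

Definition hyp_vert : finType := (E + {H : {set E} | is_hyperplane M H})%type.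

Definition hyp_is_elem (v : hyp_vert) : bool :=
  if v is inl _ then true else false.

Definition hyp_edge (u v : hyp_vert) : bool :=
  match u, v with
  | inl e, inr H | inr H, inl e => e \in sval H
  | _, _ => false
  end.

Lemma hyp_edge_sym : symmetric hyp_edge.
Proof. by move=> [e|H] [f|K]. Qed.

Lemma hyp_edge_bip u v : hyp_edge u v -> hyp_is_elem u != hyp_is_elem v.
Proof. by case: u v => [e|H] [f|K]. Qed.

Definition hyperplane_graph : bigraph := BiGraph hyp_edge_sym hyp_edge_bip.

Definition elem_vert (e : E) : vert hyperplane_graph := inl e.

End HyperplaneGraph.

Definition labelling := forall G : bigraph, vert G -> nat.

Definition relabelled_elem (lab : labelling) (G : bigraph) (i : nat) : Prop :=
  exists2 v : vert G, lab G v = i & is_elem v.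

Definition relabelled_edge (lab : labelling) (G : bigraph) (i j : nat) : Prop :=
  exists u v : vert G, [/\ lab G u = i, lab G v = j & edge u v].

(* The relabelled graphs live on {1, ..., #|vert G|} and {1, ..., #|vert H|}. *)
Definition same_relabelled (lab : labelling) (G H : bigraph) : Prop :=
  [/\ #|vert G| = #|vert H|,
      forall i, relabelled_elem lab G i <-> relabelled_elem lab H i &
      forall i j, relabelled_edge lab G i j <-> relabelled_edge lab H i j].

(* Only the values on hyperplane graphs are constrained. *)
Definition canonical_labelling (lab : labelling) : Prop :=
  [/\ forall M : matroid, injective (lab (hyperplane_graph M)),
      forall (M : matroid) (i : nat),
        (1 <= i <= #|vert (hyperplane_graph M)|)%N <->
        exists v, lab (hyperplane_graph M) v = i &
      forall M1 M2 : matroid,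
        (exists phi : vert (hyperplane_graph M1) -> vert (hyperplane_graph M2),
           graph_isomorphism phi) ->
        same_relabelled lab (hyperplane_graph M1) (hyperplane_graph M2)].

Definition lowest_element (lab : labelling) (G : bigraph) (v : vert G) : Prop :=
  is_elem v /\ forall w : vert G, is_elem w -> (lab G v <= lab G w)%N.

Definition accepted (lab : labelling) (E : finType) (M : matroid_on (option E))
    : Prop :=
  exists2 v : vert (hyperplane_graph M),
    lowest_element lab v & same_orbit (elem_vert M None) v.

(* The set N^+ of accepted extensions of N, before isomorphs are filtered. *)
Definition accepted_extensions (lab : labelling) (N M : matroid) : Prop :=
  exists (C : {set {set ground N}}) (M0 : matroid_on (option (ground N))),
    [/\ modular_cut N C, extension_by N C M0, accepted lab M0 &
        M = Matroid M0].

(* S is a possible result of filtering isomorphic matroids from P. *)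
Definition isomorph_filter (P S : matroid -> Prop) : Prop :=
  (forall M, S M -> P M) /\
  (forall M, P M -> exists! M', S M' /\ matroid_iso M M').

(* The filtering step leaves the choice of representatives free: X' is a
   possible output on input X, with S N the part of X' contributed by N. *)
Definition procedure_output (lab : labelling) (X X' : matroid -> Prop) : Prop :=
  exists S : matroid -> matroid -> Prop,
    (forall N, X N -> isomorph_filter (accepted_extensions lab N) (S N)) /\
    (forall M, X' M <-> exists2 N, X N & S N M).

Definition one_per_iso_class (k : nat) (X : matroid -> Prop) : Prop :=
  forall M : matroid, #|ground M| = k ->
    exists! M', X M' /\ matroid_iso M M'.

(* Main.v *)
Require Import Defs.
From mathcomp Require Import all_boot all_order all_algebra.
From mathcomp Require Import zify.

Set Implicit Arguments.
Unset Strict Implicit.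
Unset Printing Implicit Defensive.

Import Order.TTheory GRing.Theory Num.Theory.
Local Open Scope ring_scope.

(** Write [f] for the lowest element of a matroid [M]: the element whose vertex
    has the lowest canonical label in the hyperplane graph. Two facts make the
    orbit test pick out, up to isomorphism, one parent of [M].

    First, a canonical labelling turns every isomorphism class of hyperplane
    graphs into label-preserving isomorphisms ([canonical_iso]), and these send
    lowest element to lowest element. So being in the orbit of the lowest
    element is a property invariant under isomorphism.

    Second, hyperplane graphs and matroids carry the same information: an
    isomorphism of matroids acts on hyperplanes ([graph_iso_of_rk]), and an
    isomorphism of hyperplane graphs preserves rank ([rk_of_graph_iso]).

    Existence: delete [f] from [M] and let [N] be the representative of
    [M \ f]. Carry [M] over to the ground set of [N] plus a new point put in
    the place of [f]. Crapo's theorem makes the result an extension of [N] by a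
    modular cut ([crapo_extension]), and its new point lies in the orbit of the
    lowest element, so it is accepted ([accepted_extension_exists]).

    Uniqueness: if two accepted extensions are isomorphic, then composing with
    orbit automorphisms gives an isomorphism of hyperplane graphs that matches
    the two new points. It restricts to an isomorphism of the parents
    ([accepted_parent_iso]), which are then equal because the input has one
    matroid per class; the filter applied to that single parent keeps only one
    of the extensions.

    Throughout, matroids are compared through the relation [spans]: the rank
    of a set is the number of points that are not spanned by their predecessors
    in an enumeration of it, so a map that respects spanning respects rank
    ([rk_of_spans]). Spanning can be read off the flats or off the hyperplanes
    alone, which is how an equality of families of flats, or an isomorphism of
    hyperplane graphs, is converted into an equality of ranks. *)

(** * Spanning, flats and hyperplanes *)

Definition spans (E : finType) (M : matroid_on E) (A : {set E}) (e : E) : bool :=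
  rk M (A :|: [set e]) == rk M A.

Definition closure (E : finType) (M : matroid_on E) (A : {set E}) : {set E} :=
  [set e | spans M A e].

Section Spanning.
Variables (E : finType) (M : matroid_on E).
Implicit Types (A B F H : {set E}) (e f : E).

Lemma rk_set0 : rk M set0 = 0.
Proof. by have := rk_bounds M set0; rewrite cards0; lia. Qed.

(** Submodularity in the form in which it is used: the two sets on the left are
    rarely literally an intersection and a union. *)
Lemma rk_submod_sub (A B C D : {set E}) : C \subset A :&: B -> D \subset A :|: B ->
  rk M C + rk M D <= rk M A + rk M B.
Proof.
move=> /(rk_mono M) hC /(rk_mono M) hD.
by have := rk_submod M A B; lia.
Qed.

(** A boolean is read as the integer 0 or 1: adding a point raises the rank by
    one exactly when the point is not spanned. *)
Lemma rk_add1 A e : rk M (A :|: [set e]) = rk M A + (~~ spans M A e)%:Z.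
Proof.
have h1 : rk M A <= rk M (A :|: [set e]) by apply: rk_mono; apply: subsetUl.
have h2 : rk M set0 + rk M (A :|: [set e]) <= rk M A + rk M [set e].
  by apply: rk_submod_sub; rewrite ?sub0set.
have h3 := rk_bounds M [set e].
move: h2 h3; rewrite rk_set0 cards1 /spans.
by case: eqP => /=; lia.
Qed.

Lemma spans_in A e : e \in A -> spans M A e.
Proof. by move=> eA; rewrite /spans (setUidPl _) ?sub1set. Qed.

Lemma spans_sub A B e : A \subset B -> spans M A e -> spans M B e.
Proof.
move=> sAB /eqP h.
have hs : rk M A + rk M (B :|: [set e]) <= rk M (A :|: [set e]) + rk M B.
  apply: rk_submod_sub; first by rewrite subsetI subsetUl.
  by rewrite -setUA (setUC _ B) subsetUr.
have : rk M B <= rk M (B :|: [set e]) by apply: rk_mono; apply: subsetUl.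
by rewrite /spans; lia.
Qed.

(** Adding the points of [B] to [A] one at a time never changes the rank, since
    each stays spanned by the larger set. *)
Lemma rk_spanned A B : A \subset B -> (forall e, e \in B -> spans M A e) ->
  rk M B = rk M A.
Proof.
move=> sAB hB.
suff h (s : seq E) : {subset s <= B} -> rk M (A :|: [set x in s]) = rk M A.
  have := h (enum B); rewrite set_enum (setUidPr sAB); apply.
  by move=> x; rewrite mem_enum.
elim: s => [|x s IH] hs.
  by congr rk; apply/setP=> y; rewrite !inE orbF.
have -> : A :|: [set y in x :: s] = (A :|: [set y in s]) :|: [set x].
  by apply/setP=> y; rewrite !inE; case: (y == x); rewrite ?orbT ?orbF.
rewrite -IH; last by move=> y ys; apply: hs; rewrite inE ys orbT.
apply/eqP/(spans_sub (subsetUl _ _))/hB/hs.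
by rewrite mem_head.
Qed.

Lemma sub_closure A : A \subset closure M A.
Proof. by apply/subsetP=> e eA; rewrite inE spans_in. Qed.

Lemma rk_closure A : rk M (closure M A) = rk M A.
Proof.
by apply: rk_spanned; [apply: sub_closure | move=> e; rewrite inE].
Qed.

Lemma flatP F : reflect (forall e, spans M F e -> e \in F) (is_flat M F).
Proof.
apply: (iffP forallP) => h e; have := h e.
  move=> /implyP h' hs; apply/negPn/negP=> /h'.
  by rewrite (eqP hs) ltxx.
move=> h'; apply/implyP=> eF; rewrite rk_add1.
by case hs : (spans M F e); [rewrite h' in eF | rewrite /=; lia].
Qed.

Lemma closure_flat A : is_flat M (closure M A).
Proof.
apply/flatP=> e /eqP h; rewrite inE /spans; apply/eqP.
have h1 : rk M (A :|: [set e]) <= rk M (closure M A :|: [set e]).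
  by apply/rk_mono/setSU/sub_closure.
have h2 : rk M A <= rk M (A :|: [set e]) by apply: rk_mono; apply: subsetUl.
by move: h; rewrite rk_closure in h1 h2 * => h; lia.
Qed.

Lemma closure_sub_flat A F : is_flat M F -> A \subset F -> closure M A \subset F.
Proof.
move=> /flatP hF sAF; apply/subsetP=> e; rewrite inE => he.
exact/hF/(spans_sub sAF).
Qed.

Lemma spans_flatsP A e :
  reflect (forall F, is_flat M F -> A \subset F -> e \in F) (spans M A e).
Proof.
apply: (iffP idP) => [hs F /flatP hF sAF|h].
  exact/hF/(spans_sub sAF).
by have := h _ (closure_flat A) (sub_closure A); rewrite inE.
Qed.

Lemma flatI F G : is_flat M F -> is_flat M G -> is_flat M (F :&: G).
Proof.
move=> /flatP hF /flatP hG; apply/flatP=> e he; rewrite inE.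
by rewrite hF ?hG //; apply: spans_sub he; rewrite ?subsetIl ?subsetIr.
Qed.

Lemma flat_rk_proper F B : is_flat M F -> F \proper B -> rk M F < rk M B.
Proof.
move=> /flatP hF /properP[sFB [e eB eF]].
have : rk M (F :|: [set e]) <= rk M B by apply: rk_mono; rewrite subUset sFB sub1set.
by rewrite rk_add1; have /negPf-> := contra (hF e) eF; rewrite /=; lia.
Qed.

(** A set maximal among those that contain [A] and do not span [e] is a
    hyperplane: by maximality every outside point [f] makes it span [e], and
    exchanging [e] and [f] shows that adding [e] already spans everything. *)
Lemma hyperplane_avoiding A e : ~~ spans M A e ->
  exists H, [/\ is_hyperplane M H, A \subset H & e \notin H].
Proof.
move=> hA.
have [H /maxsetP[hH maxH] sAH] := maxset_exists (P := fun H => ~~ spans M H e) hA.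
have eH : e \notin H by apply: contra hH; apply: spans_in.
have spanadd f : f \notin H -> spans M (H :|: [set f]) e.
  move=> fH; apply/negPn/negP=> hf.
  have := maxH _ hf (subsetUl _ _) => /setP/(_ f).
  by rewrite !inE eqxx orbT (negPf fH).
have flatH : is_flat M H.
  apply/flatP=> f hf; apply/negPn/negP=> fH; case/negP: hH.
  have := spanadd f fH; rewrite /spans (eqP hf) => /eqP h.
  have : rk M (H :|: [set e]) <= rk M (H :|: [set f] :|: [set e]).
    by apply: rk_mono; rewrite setUAC subsetUl.
  have : rk M H <= rk M (H :|: [set e]) by apply: rk_mono; apply: subsetUl.
  by lia.
exists H; split=> //; rewrite /is_hyperplane flatH /=.
(* the exchange step: the set with [f] and [e] has the rank of the set with [f] *)
have hE : rk M [set: E] = rk M (H :|: [set e]).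
  apply: rk_spanned; first exact: subsetT.
  move=> f _; have [fH|fH] := boolP (f \in H).
    by apply: spans_in; rewrite inE fH.
  have := spanadd f fH; rewrite /spans setUAC => /eqP->.
  rewrite !rk_add1 hH.
  by have /negPf-> := contra ((flatP _ flatH) f) fH.
by rewrite hE rk_add1 hH /=; lia.
Qed.

Lemma spans_hyperplanesP A e :
  reflect (forall H, is_hyperplane M H -> A \subset H -> e \in H) (spans M A e).
Proof.
apply: (iffP idP) => [hs H /andP[hF _]|h]; first exact: (spans_flatsP A e hs).
apply/negPn/negP=> /hyperplane_avoiding[H [hH sAH]].
by rewrite h.
Qed.

End Spanning.

(** Only the spanning relation enters [rk_add1], so the rank is rebuilt from it
    one point at a time. The map need not be onto, which lets the lemma compare a
    matroid both with an isomorphic one and with an extension. *)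
Lemma rk_of_spans (E1 E2 : finType) (M1 : matroid_on E1) (M2 : matroid_on E2)
    (rho : E1 -> E2) :
  (forall (A : {set E1}) e, spans M2 (rho @: A) (rho e) = spans M1 A e) ->
  forall A : {set E1}, rk M2 (rho @: A) = rk M1 A.
Proof.
move=> hs A; rewrite -[A]set_enum.
elim: (enum A) => [|x s IH].
  have -> : [set y in [::]] = set0 :> {set E1} by apply/setP=> y; rewrite !inE.
  by rewrite imset0 !rk_set0.
have -> : [set y in x :: s] = [set y in s] :|: [set x].
  by apply/setP=> y; rewrite !inE orbC.
by rewrite imsetU imset_set1 !rk_add1 IH hs.
Qed.

(** * Restriction along an injection *)

(** One construction serves twice: along the inclusion of the complement of a
    point it is deletion, along a bijection it transports a matroid to another
    ground set. *)
Section Pullback.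
Variables (E1 E2 : finType) (rho : E1 -> E2) (rhoI : injective rho).
Variable M : matroid_on E2.

Definition pullback_rk (A : {set E1}) : int := rk M (rho @: A).

Lemma pullback_bounds A : 0 <= pullback_rk A <= #|A|%:Z.
Proof. by have := rk_bounds M (rho @: A); rewrite card_imset. Qed.

Lemma pullback_mono (A B : {set E1}) :
  A \subset B -> pullback_rk A <= pullback_rk B.
Proof. by move=> sAB; apply/rk_mono/imsetS. Qed.

Lemma pullback_submod (A B : {set E1}) :
  pullback_rk (A :&: B) + pullback_rk (A :|: B) <= pullback_rk A + pullback_rk B.
Proof.
rewrite /pullback_rk imsetU imsetI; last by move=> ? ? _ _ /rhoI.
exact: rk_submod.
Qed.

Definition pullback : matroid_on E1 :=
  MatroidOn pullback_bounds pullback_mono pullback_submod.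

End Pullback.

(** * Matroid isomorphisms and hyperplane graph isomorphisms *)

Section Isomorphisms.

Lemma matroid_iso_refl M : matroid_iso M M.
Proof. by exists id => [|A]; [exists id | rewrite imset_id]. Qed.

Lemma matroid_iso_sym M1 M2 : matroid_iso M1 M2 -> matroid_iso M2 M1.
Proof.
case=> rho [rho' K K'] h; exists rho' => [|A]; first by exists rho.
rewrite -h -imset_comp; congr rk; rewrite -[RHS]imset_id.
by apply: eq_imset => x /=; rewrite K'.
Qed.

Lemma matroid_iso_trans M1 M2 M3 :
  matroid_iso M1 M2 -> matroid_iso M2 M3 -> matroid_iso M1 M3.
Proof.
case=> r1 b1 h1 [r2 b2 h2]; exists (r2 \o r1) => [|A]; first exact: bij_comp.
by rewrite imset_comp h2 h1.
Qed.

Lemma graph_iso_comp (G1 G2 G3 : bigraph) (f : vert G1 -> vert G2)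
    (g : vert G2 -> vert G3) :
  graph_isomorphism f -> graph_isomorphism g -> graph_isomorphism (g \o f).
Proof.
case=> b1 e1 d1 [b2 e2 d2]; split=> [|v|u v] /=; first exact: bij_comp.
  by rewrite e2 e1.
by rewrite d2 d1.
Qed.

Lemma graph_iso_inv (G H : bigraph) (f : vert G -> vert H) :
  graph_isomorphism f ->
  exists2 g : vert H -> vert G, graph_isomorphism g & cancel f g.
Proof.
case=> [[g K K'] e d]; exists g => //; split=> [|v|u v].
- by exists f.
- by rewrite -e K'.
- by rewrite -d !K'.
Qed.

End Isomorphisms.

Lemma iso_hyperplane (E1 E2 : finType) (M1 : matroid_on E1) (M2 : matroid_on E2)
    (rho : E1 -> E2) (bij : bijective rho) :
  (forall A : {set E1}, rk M2 (rho @: A) = rk M1 A) ->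
  forall H, is_hyperplane M1 H -> is_hyperplane M2 (rho @: H).
Proof.
move=> h H /andP[/flatP hF hr].
have [rho' K K'] := bij.
apply/andP; split.
  apply/flatP=> e; rewrite -(K' e) mem_imset; last exact: bij_inj.
  by move=> hs; apply: hF; move: hs; rewrite /spans -imset_set1 -imsetU !h.
have -> : [set: E2] = rho @: [set: E1].
  by apply/setP=> y; rewrite -(K' y) mem_imset ?inE //; apply: bij_inj.
by rewrite !h.
Qed.

Lemma graph_iso_of_rk (E1 E2 : finType) (M1 : matroid_on E1)
    (M2 : matroid_on E2) (rho : E1 -> E2) :
  bijective rho -> (forall A : {set E1}, rk M2 (rho @: A) = rk M1 A) ->
  exists2 phi : vert (hyperplane_graph M1) -> vert (hyperplane_graph M2),
    graph_isomorphism phi & forall e, phi (elem_vert M1 e) = elem_vert M2 (rho e).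
Proof.
move=> bij h; have [rho' K K'] := bij.
have bij' : bijective rho' by exists rho.
have h' (A : {set E2}) : rk M1 (rho' @: A) = rk M2 A.
  rewrite -h -imset_comp; congr rk; rewrite -[RHS]imset_id.
  by apply: eq_imset => x /=; rewrite K'.
pose phi (v : hyp_vert M1) : hyp_vert M2 := match v with
  | inl e => inl (rho e)
  | inr H => inr (exist _ (rho @: sval H) (iso_hyperplane bij h (svalP H)))
  end.
pose phi' (v : hyp_vert M2) : hyp_vert M1 := match v with
  | inl e => inl (rho' e)
  | inr H => inr (exist _ (rho' @: sval H) (iso_hyperplane bij' h' (svalP H)))
  end.
exists phi => //; split.
- exists phi' => -[e|H] /=; rewrite ?K ?K' //; congr inr; apply: val_inj => /=;
    rewrite -imset_comp -[RHS]imset_id; apply: eq_imset => x /=; by rewrite ?K ?K'.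
- by case.
- by move=> [e|H] [f|G] //=; rewrite mem_imset //; apply: bij_inj.
Qed.

(** Adjacency in the graph is membership in hyperplanes, and hyperplanes decide
    spanning by [spans_hyperplanesP]. *)
Lemma rk_of_graph_iso (E1 E2 : finType) (M1 : matroid_on E1)
    (M2 : matroid_on E2)
    (phi : vert (hyperplane_graph M1) -> vert (hyperplane_graph M2)) :
  graph_isomorphism phi ->
  exists rho : E1 -> E2,
    [/\ bijective rho, forall e, phi (elem_vert M1 e) = elem_vert M2 (rho e) &
        forall A : {set E1}, rk M2 (rho @: A) = rk M1 A].
Proof.
case=> [[psi K K'] helem hedge].
have helem' v : is_elem (psi v) = is_elem v by rewrite -helem K'.
have /fin_all_exists[rho hrho] (e : E1) :
    exists x : E2, phi (elem_vert M1 e) = elem_vert M2 x.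
  by have := helem (elem_vert M1 e); case: (phi _) => // x _; exists x.
have /fin_all_exists[rho' hrho'] (e : E2) :
    exists x : E1, psi (elem_vert M2 e) = elem_vert M1 x.
  by have := helem' (elem_vert M2 e); case: (psi _) => // x _; exists x.
have rhoK : cancel rho rho'.
  by move=> e; have := K (elem_vert M1 e); rewrite hrho hrho' => -[].
have rhoK' : cancel rho' rho.
  by move=> e; have := K' (elem_vert M2 e); rewrite hrho' hrho => -[].
exists rho; split=> //; first by exists rho'.
have imH H : is_hyperplane M1 H -> is_hyperplane M2 (rho @: H).
  move=> hH; pose v : vert (hyperplane_graph M1) := inr (exist _ H hH).
  have := helem v; case E : (phi v) => [//|G] _.
  suff -> : rho @: H = sval G by exact: (proj2_sig G).
  apply/setP=> x; rewrite -(rhoK' x) mem_imset; last exact: can_inj rhoK.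
  by have := hedge (elem_vert M1 (rho' x)) v; rewrite hrho E.
have preH H : is_hyperplane M2 H -> is_hyperplane M1 (rho @^-1: H).
  move=> hH; pose v : vert (hyperplane_graph M2) := inr (exist _ H hH).
  have := helem' v; case E : (psi v) => [//|G] _.
  suff -> : rho @^-1: H = sval G by exact: (proj2_sig G).
  apply/setP=> x; rewrite inE.
  by have := hedge (elem_vert M1 x) (psi v); rewrite hrho K' E.
apply: rk_of_spans => A e; apply/spans_hyperplanesP/spans_hyperplanesP => h H hH sAH.
  have := h _ (imH _ hH) (imsetS _ sAH).
  by rewrite mem_imset //; apply: can_inj rhoK.
have := h _ (preH _ hH); rewrite inE; apply.
by rewrite -sub_imset_pre.
Qed.

(** * Single-element extensions *)

Section Extensions.
Variables (E : finType) (N : matroid_on E).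
Implicit Types (F G A : {set E}) (C : {set {set E}}).

Lemma imset_Some_None A : None \notin Some @: A.
Proof. by apply/imsetP=> -[]. Qed.

Lemma mem_imset_Some A e : (Some e \in Some @: A) = (e \in A).
Proof. by rewrite mem_imset //; apply: Some_inj. Qed.

Lemma split_None (X : {set option E}) :
  X = Some @: (Some @^-1: X) :|: (if None \in X then [set None] else set0).
Proof.
apply/setP=> -[e|]; rewrite inE ?mem_imset_Some ?inE.
  by case: ifP; rewrite !inE ?orbF.
by rewrite (negPf (imset_Some_None _)); case: ifP; rewrite !inE.
Qed.

Lemma imset_Some_None_inj F G :
  Some @: F :|: [set None] = Some @: G :|: [set None] -> F = G.
Proof.
move=> /setP h; apply/setP=> e; have := h (Some e).
by rewrite !inE !mem_imset_Some !orbF.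
Qed.

Lemma collar_cut_disjoint C F : F \in collar N C -> F \notin C.
Proof. by rewrite !inE => /and3P[]. Qed.

Lemma extension_flats_Some C F : C \subset flats N ->
  (Some @: F \in extension_flats N C) = is_flat N F && (F \notin C).
Proof.
move=> sC; apply/idP/idP.
  case/setUP=> /imsetP[G hG eqF]; last first.
    by have := imset_Some_None F; rewrite eqF !inE eqxx orbT.
  have {eqF} -> : F = G by apply: (imset_inj (@Some_inj _)).
  case/setUP: hG => [/setDP[hG]|hG].
    by rewrite inE negb_or => /andP[_ ->]; move: hG; rewrite inE => ->.
  by rewrite (collar_cut_disjoint hG) andbT; move: hG; rewrite !inE => /andP[].
move=> /andP[hF nC]; apply/setUP; left; apply: imset_f.
by rewrite in_setU in_setD in_setU [F \in flats N]inE hF (negPf nC) orbF andbT orNb.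
Qed.

Lemma extension_flats_None C F : C \subset flats N ->
  (Some @: F :|: [set None] \in extension_flats N C) =
    is_flat N F && (F \notin collar N C).
Proof.
move=> sC; apply/idP/idP.
  case/setUP=> /imsetP[G hG eqF].
    by have := imset_Some_None G; rewrite -eqF !inE eqxx orbT.
  have {eqF} -> : F = G by apply: imset_Some_None_inj.
  case/setUP: hG => [/setDP[hG]|hG].
    by rewrite inE negb_or => /andP[-> _]; move: hG; rewrite inE => ->.
  have := subsetP sC _ hG; rewrite inE => ->.
  by apply/negP=> /collar_cut_disjoint; rewrite hG.
move=> /andP[hF nC]; apply/setUP; right; apply/imset_f/setUP.
have [?|nF] := boolP (F \in C); [by right | left].
by rewrite in_setD in_setU (negPf nC) (negPf nF) inE.
Qed.

(** Every flat of [N] is the trace of a flat of the extension, and conversely: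
    [F] itself if [F] is outside the cut, and [F] with the new point if [F] is
    in the cut. As spanning is decided by flats, deleting the new point from the
    extension gives back [N]. *)
Lemma extension_rk C (M : matroid_on (option E)) :
  C \subset flats N -> extension_by N C M ->
  forall A, rk M (Some @: A) = rk N A.
Proof.
move=> sC hM; apply: rk_of_spans => A e.
have flM X : is_flat M X = (X \in extension_flats N C) by rewrite -hM inE.
apply/spans_flatsP/spans_flatsP => h F hF sAF.
  have [FC|FC] := boolP (F \in C).
    have := h (Some @: F :|: [set None]).
    rewrite flM extension_flats_None // hF /=.
    rewrite (contraL (@collar_cut_disjoint C F)) // => /(_ isT).
    rewrite subsetU ?imsetS // => /(_ isT).
    by rewrite inE mem_imset_Some inE orbF.
  have := h (Some @: F); rewrite flM extension_flats_Some // hF FC.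
  by move=> /(_ isT (imsetS _ sAF)); rewrite mem_imset_Some.
have := h (Some @^-1: F); rewrite inE -sub_imset_pre; apply=> //.
move: hF; rewrite flM [X in X \in extension_flats _ _](split_None F).
case: ifP => _; rewrite ?setU0.
  by rewrite extension_flats_None // => /andP[].
by rewrite extension_flats_Some // => /andP[].
Qed.

(** In this section [M] is an arbitrary extension of [N], given by its rank
    function; Crapo's theorem recovers it from a modular cut. *)
Section Crapo.
Variable M : matroid_on (option E).
Hypothesis hM : forall A, rk M (Some @: A) = rk N A.

Definition crapo_cut : {set {set E}} := [set F in flats N | spans M (Some @: F) None].

Lemma in_crapo_cut F : (F \in crapo_cut) = is_flat N F && spans M (Some @: F) None.
Proof. by rewrite !inE. Qed.

Lemma spans_Some A e : spans M (Some @: A) (Some e) = spans N A e.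
Proof. by rewrite /spans -imset_set1 -imsetU !hM. Qed.

Lemma crapo_cut_modular : modular_cut N crapo_cut.
Proof.
split=> [|F G|F G].
- by apply/subsetP=> F; rewrite inE => /andP[].
- rewrite !in_crapo_cut inE => /andP[_ hF] -> sFG /=.
  exact: spans_sub (imsetS _ sFG) hF.
rewrite !in_crapo_cut => /andP[fF /eqP hF] /andP[fG /eqP hG] /eqP hmod.
rewrite flatI //= /spans; apply/eqP.
have h1 : rk M (Some @: (F :&: G) :|: [set None]) + rk M (Some @: (F :|: G)) <=
    rk M (Some @: F :|: [set None]) + rk M (Some @: G :|: [set None]).
  apply: rk_submod_sub.
    by rewrite subsetI !setSU // imsetS ?subsetIl ?subsetIr.
  by rewrite imsetU setUSS ?subsetUl.
have h2 : rk M (Some @: (F :&: G)) <= rk M (Some @: (F :&: G) :|: [set None]).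
  by apply: rk_mono; apply: subsetUl.
move: h1 h2; rewrite hF hG !hM hmod addrC lerD2l => h1 h2.
by apply/eqP; rewrite eq_le h1 h2.
Qed.

(** For a flat [F] outside the cut, the new point raises the rank of [F] by one.
    If a member [G] of the cut covers [F], then [G] is spanned by [F] and any
    [f] of [G] outside [F], so [F] with the new point already has the rank of
    [G] with the new point and spans [f]. If [F] with the new point spans an
    outside [f], then [F] with [f] spans the new point by exchange, and its
    closure is the covering member of the cut. *)
Lemma in_crapo_collar F : is_flat N F ->
  (F \in collar N crapo_cut) =
    (F \notin crapo_cut) &&
    [exists f, (f \notin F) && spans M (Some @: F :|: [set None]) (Some f)].
Proof.
move=> hF; rewrite inE inE hF /=; case: (boolP (F \in crapo_cut)) => //= FC.
have e1 : rk M (Some @: F :|: [set None]) = rk N F + 1.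
  rewrite rk_add1 hM; move: FC; rewrite in_crapo_cut hF /= => -> //.
have add1 f : f \notin F -> rk N (F :|: [set f]) = rk N F + 1.
  by move=> fF; rewrite rk_add1 (contra ((flatP _ _ hF) f) fF).
have addE f : Some @: F :|: [set None] :|: [set Some f] =
    Some @: (F :|: [set f]) :|: [set None].
  by rewrite setUAC imsetU imset_set1.
apply/exists_inP/existsP => [[G GC /andP[/properP[sFG [f fG fF]] hcov]]|[f /andP[fF hs]]].
  exists f; rewrite fF /spans eq_le /=; apply/andP; split; last by apply: rk_mono; apply: subsetUl.
  move: GC; rewrite in_crapo_cut => /andP[flG /eqP hG].
  have sub : closure N (F :|: [set f]) \subset G.
    by apply: closure_sub_flat => //; rewrite subUset sFG sub1set.
  have eqG : closure N (F :|: [set f]) = G.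
    apply/eqP; rewrite eqEproper sub /=; apply: contra hcov => pG.
    apply/exists_inP; exists (closure N (F :|: [set f])).
      by rewrite inE closure_flat.
    rewrite pG andbT; apply/properP; split.
      exact: subset_trans (subsetUl _ _) (sub_closure _ _).
    by exists f => //; apply: (subsetP (sub_closure _ _)); rewrite !inE eqxx orbT.
  have : rk M (Some @: F :|: [set None] :|: [set Some f]) <=
      rk M (Some @: G :|: [set None]).
    by rewrite addE; apply/rk_mono/setSU/imsetS; rewrite subUset sFG sub1set.
  by rewrite hG hM -eqG rk_closure add1 // e1.
(* conversely, the covering flat is the closure of [F] with [f] *)
exists (closure N (F :|: [set f])).
  rewrite in_crapo_cut closure_flat /=.
  apply: (spans_sub (imsetS _ (sub_closure _ _))).
  by rewrite /spans -addE (eqP hs) e1 hM add1.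
have pF : F \proper closure N (F :|: [set f]).
  apply/properP; split.
    exact: subset_trans (subsetUl _ _) (sub_closure _ _).
  by exists f => //; apply: (subsetP (sub_closure _ _)); rewrite !inE eqxx orbT.
rewrite /covers pF /=; apply/exists_inP=> -[G]; rewrite inE => hG /andP[p1 p2].
have := flat_rk_proper hF p1; have := flat_rk_proper hG p2.
by rewrite rk_closure add1 //; lia.
Qed.

(** A set without the new point is a flat of [M] when it is a flat of [N] that
    does not span the new point. A set [F] with the new point is a flat of [M]
    when [F] is a flat of [N] and no further point becomes spanned, which by
    [in_crapo_collar] says that [F] is not in the collar. *)
Lemma crapo_extension : extension_by N crapo_cut M.
Proof.
have [sC _ _] := crapo_cut_modular.
apply/setP=> X; rewrite inE (split_None X); move: (Some @^-1: X) => F.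
case: ifP => _; rewrite ?setU0.
  rewrite extension_flats_None //; apply/flatP/andP => [h|[hF]].
    have hF : is_flat N F.
      apply/flatP=> f; rewrite -spans_Some => hs.
      have := h (Some f) (spans_sub (subsetUl _ _) hs).
      by rewrite inE mem_imset_Some inE orbF.
    split=> //; rewrite in_crapo_collar // negb_and; apply/orP; right.
    apply/existsP=> -[f /andP[fF /h]].
    by rewrite inE mem_imset_Some inE orbF (negPf fF).
  rewrite in_crapo_collar // negb_and => /orP[FC|hex] [f|]; rewrite !inE ?eqxx ?orbT ?orbF //.
    move: FC; rewrite negbK in_crapo_cut mem_imset_Some => /andP[_ /eqP hs] hf.
    apply: ((flatP _ _ hF) f); rewrite -spans_Some.
    have h1 : rk M (Some @: F :|: [set Some f]) <=
        rk M (Some @: F :|: [set None] :|: [set Some f]).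
      by apply: rk_mono; rewrite setSU // subsetUl.
    have h2 : rk M (Some @: F) <= rk M (Some @: F :|: [set Some f]).
      by apply: rk_mono; apply: subsetUl.
    move: hf; rewrite {1}/spans hs => /eqP hf; rewrite hf in h1.
    by rewrite /spans eq_le h1 h2.
  move=> hs; rewrite mem_imset_Some; apply/negPn/negP=> fF.
  by case/existsP: hex; exists f; rewrite fF.
rewrite extension_flats_Some // in_crapo_cut.
apply/flatP/andP => [h|[hF]].
  have hF : is_flat N F.
    by apply/flatP=> f; rewrite -spans_Some => /h; rewrite mem_imset_Some.
  rewrite hF; split=> //=; apply/negP=> /h.
  by rewrite (negPf (imset_Some_None _)).
rewrite hF /= => hs [f|]; last by rewrite (negPf hs).
by rewrite spans_Some mem_imset_Some; apply: (flatP _ _ hF).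
Qed.

End Crapo.
End Extensions.

(** * Canonical labels and accepted extensions *)

Section CanonicalLabels.
Variables (lab : labelling) (hlab : canonical_labelling lab).

(** Sending each vertex to the vertex of the other graph with the same label is
    an isomorphism, since the two relabelled graphs are identical. *)
Lemma canonical_iso (M1 M2 : matroid)
    (phi : vert (hyperplane_graph M1) -> vert (hyperplane_graph M2)) :
  graph_isomorphism phi ->
  exists2 psi : vert (hyperplane_graph M1) -> vert (hyperplane_graph M2),
    graph_isomorphism psi & forall v, lab (psi v) = lab v.
Proof.
case: hlab => labI labR labC hphi.
have [ecard eelem eedge] := labC M1 M2 (ex_intro _ phi hphi).
have /fin_all_exists[psi hpsi] (v : vert (hyperplane_graph M1)) :
    exists w : vert (hyperplane_graph M2), lab w = lab v.
  by apply/labR; rewrite -ecard; apply/labR; exists v.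
exists psi => //; split.
- apply: inj_card_bij; last by rewrite ecard.
  by move=> u v h; apply: (labI M1); rewrite -!hpsi h.
- move=> v; apply/idP/idP => hv.
    have /eelem[u hu eu] : relabelled_elem lab (hyperplane_graph M2) (lab v).
      by exists (psi v).
    by rewrite -(labI M1 _ _ hu).
  have /eelem[u hu eu] : relabelled_elem lab (hyperplane_graph M1) (lab v).
    by exists v.
  by have -> : psi v = u by apply: (labI M2); rewrite hpsi hu.
- move=> u v; apply/idP/idP => huv.
    have /eedge[u' [v' [hu hv e]]] :
        relabelled_edge lab (hyperplane_graph M2) (lab u) (lab v).
      by exists (psi u), (psi v).
    by rewrite -(labI M1 _ _ hu) -(labI M1 _ _ hv).
  have /eedge[u' [v' [hu hv e]]] :
      relabelled_edge lab (hyperplane_graph M1) (lab u) (lab v).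
    by exists u, v.
  have -> : psi u = u' by apply: (labI M2); rewrite hpsi hu.
  by have -> : psi v = v' by apply: (labI M2); rewrite hpsi hv.
Qed.

Lemma canonical_iso_lowest (M1 M2 : matroid)
    (psi : vert (hyperplane_graph M1) -> vert (hyperplane_graph M2))
    (v : vert (hyperplane_graph M1)) :
  graph_isomorphism psi -> (forall v, lab (psi v) = lab v) ->
  lowest_element lab v -> lowest_element lab (psi v).
Proof.
case=> [[psi' K K'] helem _] hpsi [ev hv]; split; first by rewrite helem.
by move=> w; rewrite -(K' w) helem !hpsi; apply: hv.
Qed.

Lemma lowest_unique (M : matroid) (v w : vert (hyperplane_graph M)) :
  lowest_element lab v -> lowest_element lab w -> v = w.
Proof.
case: hlab => labI _ _ [ev hv] [ew hw]; apply: (labI M).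
by apply/eqP; rewrite eqn_leq hv // hw.
Qed.

(** Go from the first new point to the lowest element by an automorphism, cross
    over by the label-preserving isomorphism, and come back from the lowest
    element to the second new point. *)
Lemma accepted_iso (E1 E2 : finType) (M1 : matroid_on (option E1))
    (M2 : matroid_on (option E2)) :
  accepted lab M1 -> accepted lab M2 ->
  matroid_iso (Matroid M1) (Matroid M2) ->
  exists2 phi : vert (hyperplane_graph M1) -> vert (hyperplane_graph M2),
    graph_isomorphism phi & phi (elem_vert M1 None) = elem_vert M2 None.
Proof.
case=> v1 low1 [a1 ha1 av1] [v2 low2 [a2 ha2 av2]] [rho bij h].
have [phi hphi _] := graph_iso_of_rk bij h.
have [psi hpsi hl] := canonical_iso (M1 := Matroid M1) (M2 := Matroid M2) hphi.
have [b2 hb2 K2] := graph_iso_inv ha2.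
exists (b2 \o (psi \o a1)).
  exact: graph_iso_comp (graph_iso_comp ha1 hpsi) hb2.
rewrite /= av1.
have -> : psi v1 = v2.
  apply: (@lowest_unique (Matroid M2)) => //.
  exact: (@canonical_iso_lowest (Matroid M1) (Matroid M2)).
by rewrite -av2 K2.
Qed.

(** The graph isomorphism induced by [rho], followed by a label-preserving
    isomorphism in the other direction, is an automorphism that takes the new
    point to the lowest element. *)
Lemma accepted_of_lowest (E F : finType) (M : matroid_on (option E))
    (M0 : matroid_on F) (rho : option E -> F) :
  bijective rho -> (forall A : {set option E}, rk M0 (rho @: A) = rk M A) ->
  lowest_element lab (elem_vert M0 (rho None)) -> accepted lab M.
Proof.
move=> bij h low.
have [phi hphi ephi] := graph_iso_of_rk bij h.
have [phi' hphi' _] := graph_iso_inv hphi.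
have [psi hpsi hl] := canonical_iso (M1 := Matroid M0) (M2 := Matroid M) hphi'.
exists (psi (elem_vert M0 (rho None))).
  exact: (@canonical_iso_lowest (Matroid M0) (Matroid M)).
exists (psi \o phi); first exact: graph_iso_comp hphi hpsi.
by rewrite /= ephi.
Qed.

Lemma lowest_exists (M : matroid) : (0 < #|ground M|)%N ->
  exists f : ground M, lowest_element lab (elem_vert M f).
Proof.
move=> /card_gt0P[f0 _].
case: (arg_minnP (P := predT) (fun f => lab (elem_vert M f)) (erefl true : predT f0)).
move=> f _ hf.
by exists f; split=> // -[g _|//]; apply: hf.
Qed.

(** The isomorphism of [accepted_iso] matches the new points, so it restricts to
    the old ones, where the ranks are those of the parents by [extension_rk]. *)
Lemma accepted_parent_iso (N1 N2 M1 M2 : matroid) :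
  accepted_extensions lab N1 M1 -> accepted_extensions lab N2 M2 ->
  matroid_iso M1 M2 -> matroid_iso N1 N2.
Proof.
case=> C1 [K1 [[sC1 _ _] ext1 acc1 ->]] [C2 [K2 [[sC2 _ _] ext2 acc2 ->]]] iso12.
have [phi hphi phiN] := accepted_iso acc1 acc2 iso12.
have [rho [[rho' K K'] erho hrho]] := rk_of_graph_iso hphi.
have rhoN : rho None = None by have := phiN; rewrite erho => -[].
have rhoN' : rho' None = None by rewrite -rhoN K.
have /fin_all_exists[g hg] (x : ground N1) : exists y, rho (Some x) = Some y.
  case e : (rho (Some x)) => [y|]; first by exists y.
  by have := K (Some x); rewrite e rhoN'.
have /fin_all_exists[g' hg'] (x : ground N2) : exists y, rho' (Some x) = Some y.
  case e : (rho' (Some x)) => [y|]; first by exists y.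
  by have := K' (Some x); rewrite e rhoN.
exists g => [|A].
  exists g' => x; apply: Some_inj.
    by rewrite -hg' -hg K.
  by rewrite -hg -hg' K'.
rewrite -(extension_rk sC2 ext2) -(extension_rk sC1 ext1) -hrho -!imset_comp.
by congr rk; apply: eq_imset => x /=; rewrite hg.
Qed.

(** The isomorphism from the deletion of [f] to [N], inverted and extended by
    sending the new point to [f], identifies [M] with an extension of [N]. *)
Lemma accepted_extension_exists (M : matroid) (f : ground M) (N : matroid) :
  lowest_element lab (elem_vert M f) ->
  matroid_iso (Matroid (pullback (@val_inj _ _ {x : ground M | x != f}) M)) N ->
  exists2 M1, accepted_extensions lab N M1 & matroid_iso M1 M.
Proof.
move=> low [sg [sg' K K'] hsg].
pose tau (x : option (ground N)) : ground M := if x is Some y then val (sg' y) else f.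
have tauI : injective tau.
  move=> [x|] [y|] //= h.
  - by congr Some; apply: (can_inj K'); apply: val_inj.
  - by case: (sg' x) h => z /= nz e; rewrite e eqxx in nz.
  - by case: (sg' y) h => z /= nz e; rewrite e eqxx in nz.
have tau_bij : bijective tau.
  (* [insub y] is [None] exactly when [y] is the deleted point [f] *)
  exists (fun y => if insub y is Some z then Some (sg z) else None).
    move=> [x|] /=; first by rewrite valK K'.
    by rewrite insubF ?eqxx.
  move=> y; case: insubP => [z _ <- /=|]; first by rewrite K.
  by rewrite negbK => /eqP ->.
pose M1 := pullback tauI M.
have hM1 (A : {set ground N}) : rk M1 (Some @: A) = rk N A.
  have -> : A = sg @: (sg' @: A).
    by rewrite -imset_comp -[LHS]imset_id; apply: eq_imset => x /=; rewrite K'.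
  rewrite hsg /= /pullback_rk -!imset_comp; congr rk.
  by apply: eq_imset => x /=; rewrite K'.
exists (Matroid M1); last by exists tau.
exists (crapo_cut N M1), M1; split=> //.
- exact: crapo_cut_modular.
- exact: crapo_extension.
- exact: accepted_of_lowest tau_bij _ low.
Qed.

End CanonicalLabels.

Theorem theorem2 (lab : labelling) (hlab : canonical_labelling lab)
    (k : nat) (X X' : matroid -> Prop)
    (hX : forall M, X M -> #|ground M| = k)
    (hout : procedure_output lab X X') :
  one_per_iso_class k X -> one_per_iso_class k.+1 X'.
Proof.
case: hout => S [hS hX'] hk M cM.
have [f low] : exists f : ground M, lowest_element lab (elem_vert M f).
  by apply: lowest_exists; rewrite cM.
pose D := Matroid (pullback (@val_inj _ _ {x : ground M | x != f}) M).
have cD : #|ground D| = k.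
  by apply: succn_inj; rewrite card_sig cardC1 cM.
have [N [[XN isoN] _]] := hk D cD.
have [M1 acc1 iso1] := accepted_extension_exists hlab low isoN.
have [M' [[SM' iso'] _]] := (hS N XN).2 _ acc1.
have isoM : matroid_iso M M' := matroid_iso_trans (matroid_iso_sym iso1) iso'.
exists M'; split; first by split=> //; apply/hX'; exists N.
move=> M'' [/hX'[N'' XN'' SM''] isoM''].
have acc' := (hS N XN).1 _ SM'; have acc'' := (hS N'' XN'').1 _ SM''.
have iso2 := matroid_iso_trans (matroid_iso_sym isoM) isoM''.
have isoNN := accepted_parent_iso hlab acc' acc'' iso2.
have eN : N'' = N.
  have [P [_ uP]] := hk N (hX N XN).
  rewrite -(uP N); first by rewrite -(uP N'').
  by split=> //; apply: matroid_iso_refl.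
rewrite eN in SM''.
have [P [_ uP]] := (hS N XN).2 _ acc'.
rewrite -(uP M'); first by rewrite -(uP M'').
by split=> //; apply: matroid_iso_refl.
Qed.
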